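(* Let $R$ be a commutative Noetherian ring with identity and let $M$ be a finitely generated unitary $R$-module. Let $n\ge 1$, let $\mathfrak{p}_1,\dots,\mathfrak{p}_n$ be distinct prime ideals in $R$ ordered so that $\mathfrak{p}_i\not\subset\mathfrak{p}_j$ for $i<j$, and let $r_1,\dots,r_n$ be positive integers. If $\mathfrak{p}_i\in\mathrm{Supp}\big(\mathfrak{p}_i^{r_i-1}\mathfrak{p}_{i+1}^{r_{i+1}}\cdots\mathfrak{p}_n^{r_n}M\big)$ for $i=1,\dots,n$, then there exists a submodule $N$ of $M$ such that $\mathcal{P}_M(N)=\mathfrak{p}_1^{r_1}\cdots\mathfrak{p}_n^{r_n}$.
   Context: Let $R$ be a commutative Noetherian ring with identity and $M$ a finitely generated $R$-module. For submodules $N, K$ of $M$, $(N:K)=\{a\in R: aK\subseteq N\}$. A proper submodule $N$ of a module $K$ is a prime submodule of $K$ if for all $a\in R$, $x\in K$, $ax\in N$ implies $a\in(N:K)$ or $x\in N$; then $\mathfrak{p}=(N:K)$ is a prime ideal and $N$ is called a $\mathfrak{p}$-prime submodule of $K$. For submodules $N\subset K$ of $M$, $K$ is a $\mathfrak{p}$-prime extension of $N$ in $M$ if $N$ is a $\mathfrak{p}$-prime submodule of $K$. It is a maximal $\mathfrak{p}$-prime extension of $N$ in $M$ if $K$ is maximal among the submodules of $M$ that are $\mathfrak{p}$-prime extensions of $N$ in $M$. A maximal $\mathfrak{p}$-prime extension $K$ of $N$ in $M$ is regular if $\mathfrak{p}$ is a maximal element (under inclusion) of $\mathrm{Ass}(M/N)$.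 For a proper submodule $N$ of $M$, a regular prime extension (RPE) filtration of $M$ over $N$ is a chain $N=M_0\subset M_1\subset\cdots\subset M_k=M$ together with primes $\mathfrak{q}_1,\dots,\mathfrak{q}_k$ such that $M_i$ is a regular $\mathfrak{q}_i$-prime extension of $M_{i-1}$ in $M$ for $1\le i\le k$. It is known that every proper submodule $N$ admits an RPE filtration and that the number of times each prime ideal occurs in it is independent of the filtration. The generalized prime ideal factorization $\mathcal{P}_M(N)$ of a proper submodule $N$ in $M$ is the product $\mathfrak{q}_1\cdots\mathfrak{q}_k$ of the primes occurring in any RPE filtration of $M$ over $N$, regarded as a formal product: the assertion $\mathcal{P}_M(N)=\mathfrak{p}_1\cdots\mathfrak{p}_n$ means that $N$ is a proper submodule of $M$ and the primes occurring in an RPE filtration of $M$ over $N$ are, counted with multiplicity and up to order, exactly $\mathfrak{p}_1,\dots,\mathfrak{p}_n$ (an exponent $r$ on a prime means that it occurs $r$ times). Inside an expression such as $\mathfrak{p}_1^{r}\mathfrak{p}_2^{s}M$ the product is the usual product of ideals, with $\mathfrak{p}^0=R$. *)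

(* Defs.v *)
From mathcomp Require Import all_boot all_order all_algebra.
From mathcomp Require Import all_classical.

Set Implicit Arguments.
Unset Strict Implicit.
Unset Printing Implicit Defensive.

Import GRing.Theory.
Local Open Scope classical_set_scope.
Local Open Scope ring_scope.

Definition maximal_among (T : Type) (F : set (set T)) (A : set T) : Prop :=
  F A /\ forall B, F B -> A `<=` B -> B = A.

Definition submodule (R : comNzRingType) (M : lmodType R) (N : set M) : Prop :=
  GRing.submod_closed (mem N).

Definition span (R : comNzRingType) (M : lmodType R) (X : set M) : set M :=
  smallest (@submodule R M) X.

Definition fin_gen (R : comNzRingType) (M : lmodType R) (N : set M) : Prop :=
  exists2 X : set M, finite_set X & N = span X.

(* [idealr_closed] only covers proper ideals; arbitrary ideals of [R] are
   treated as the submodules of [R^o]. *)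
Definition prime_ideal (R : comNzRingType) (p : set R) : Prop :=
  idealr_closed (mem p) /\ prime_idealr_closed (mem p).

Definition noetherian (R : comNzRingType) : Prop :=
  forall I : set R^o, submodule I -> fin_gen I.

Definition smul (R : comNzRingType) (M : lmodType R) (I : set R) (N : set M) :
    set M :=
  span [set a *: x | a in I & x in N].

Definition ideal_mul (R : comNzRingType) (I J : set R) : set R :=
  smul I (J : set R^o).

Definition ideal_exp (R : comNzRingType) (I : set R) (k : nat) : set R :=
  iter k (ideal_mul I) setT.

Definition colon (R : comNzRingType) (M : lmodType R) (N K : set M) : set R :=
  [set a | forall x, K x -> N (a *: x)].

Definition prime_submodule (R : comNzRingType) (M : lmodType R)
    (N K : set M) : Prop :=
  [/\ submodule N, submodule K, N `<` K
    & forall (a : R) x, K x -> N (a *: x) -> colon N K a \/ N x].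

Definition prime_extension (R : comNzRingType) (M : lmodType R)
    (p : set R) (N K : set M) : Prop :=
  prime_submodule N K /\ colon N K = p.

Definition maximal_prime_extension (R : comNzRingType) (M : lmodType R)
    (p : set R) (N K : set M) : Prop :=
  maximal_among [set L | prime_extension p N L] K.

(* Ass(M/N): [colon N [set x]] is the annihilator of the class of [x]. *)
Definition ass_quot (R : comNzRingType) (M : lmodType R) (N : set M) :
    set (set R) :=
  [set p | prime_ideal p /\ exists x : M, p = colon N [set x]].

Definition regular_prime_extension (R : comNzRingType) (M : lmodType R)
    (p : set R) (N K : set M) : Prop :=
  maximal_prime_extension p N K /\ maximal_among (ass_quot N) p.

(* Only the terms [F 0], ..., [F (size q)] are relevant; the prime attached to
   the step from [F i] to [F i.+1] is the item of index [i] in [q]. *)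
Definition rpe_filtration (R : comNzRingType) (M : lmodType R) (N : set M)
    (F : nat -> set M) (q : seq (set R)) : Prop :=
  [/\ F 0%N = N, F (size q) = setT
    & forall i, (i < size q)%N ->
        regular_prime_extension (nth set0 q i) (F i) (F i.+1)].

(* A formal product of primes is a list of primes up to permutation. *)
Definition gen_prime_factorization (R : comNzRingType) (M : lmodType R)
    (N : set M) (ps : seq (set R)) : Prop :=
  [/\ submodule N, N `<` setT
    & exists F q, rpe_filtration N F q /\ perm_eq q ps].

Definition formal_prod (R : comNzRingType) (n : nat) (p : 'I_n -> set R)
    (r : 'I_n -> nat) : seq (set R) :=
  flatten [seq nseq (r i) (p i) | i <- enum 'I_n].

(* The fraction x/s of the localization K_p, as the equivalence class of
   (x, s) in K x (R \ p). *)
Definition fraction (R : comNzRingType) (M : lmodType R) (p : set R)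
    (K : set M) (x : M) (s : R) : set (M * R) :=
  [set yt | [/\ K yt.1, ~ p yt.2
    & exists2 u, ~ p u & u *: (yt.2 *: x - s *: yt.1) = 0]].

Definition localization (R : comNzRingType) (M : lmodType R) (p : set R)
    (K : set M) : set (set (M * R)) :=
  [set fraction p K xs.1 xs.2 | xs in K `*` ~` p].

Definition supp (R : comNzRingType) (M : lmodType R) (K : set M) :
    set (set R) :=
  [set p | prime_ideal p /\ localization p K <> [set fraction p K 0 1]].

(* Main.v *)
(* Order the primes as given and build N from the top down.  If K is the
   submodule obtained from p_(i+1), ..., p_n and p = p_i, r = r_i, replace K by
   L_0 = K ∩ {x | s x ∈ p^r K for some s ∉ p}, and set L_(k+1) = (L_k : p).
   As p is not contained in any later p_j, these residuals stay inside K, and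
   L_r = K.  Each L_k is saturated in K with respect to R \ p, which makes
   L_(k+1) a regular p-prime extension of L_k as soon as it differs from L_k.
   If two consecutive terms with k < r coincided, then p^(r-1) K would equal
   p^r K locally at p, so by Nakayama p^(r-1) K would vanish at p; since K
   contains p_(i+1)^(r_(i+1)) ... p_n^(r_n) M, this contradicts the support
   hypothesis. *)
Require Import Defs.
From mathcomp Require Import all_boot all_order all_algebra.
From mathcomp Require Import all_classical.
Local Open Scope classical_set_scope.
Local Open Scope ring_scope.

Set Implicit Arguments.
Unset Strict Implicit.
Unset Printing Implicit Defensive.
Import GRing.Theory.

(* [all_algebra] shadows [Defs.span] with the span of a sequence of vectors. *)
Local Notation span := Defs.span.

(** * Submodules, spans and products of an ideal with a submodule *)

Section Submodules.
Context {R : comNzRingType} {M : lmodType R}.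
Implicit Types (N K W : set M) (I J : set R).

Lemma submoduleP N :
  submodule N <-> N 0 /\ forall a x y, N x -> N y -> N (a *: x + y).
Proof.
split=> [[N0 NL]|[N0 NL]].
  split=> [|a x y Nx Ny]; first by move: N0; rewrite inE.
  by have := NL a x y; rewrite !inE; apply.
split=> [|a x y]; first by rewrite inE.
by rewrite !inE; apply: NL.
Qed.

Section Closure.
Variables (N : set M) (subN : submodule N).

Lemma submodule0 : N 0.
Proof. by case/submoduleP: subN. Qed.

Lemma submoduleDZ a x y : N x -> N y -> N (a *: x + y).
Proof. by case/submoduleP: subN => _; apply. Qed.

Lemma submoduleZ a x : N x -> N (a *: x).
Proof. by move=> Nx; rewrite -[_ *: _]addr0; apply: submoduleDZ submodule0. Qed.

Lemma submoduleD x y : N x -> N y -> N (x + y).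
Proof. by move=> Nx; rewrite -[x]scale1r; apply: submoduleDZ. Qed.

Lemma submoduleB x y : N x -> N y -> N (x - y).
Proof. by move=> Nx Ny; rewrite addrC -scaleN1r; apply: submoduleDZ. Qed.

End Closure.

Lemma submoduleT : submodule [set: M].
Proof. exact/submoduleP. Qed.

Lemma submoduleI N K : submodule N -> submodule K -> submodule (N `&` K).
Proof.
move=> subN subK; apply/submoduleP; split; first by split; apply: submodule0.
by move=> a x y [Nx Kx] [Ny Ky]; split; apply: submoduleDZ.
Qed.

Lemma span_submodule (X : set M) : submodule (span X).
Proof.
apply/submoduleP; split=> [N [subN _]|a x y Nx Ny N [subN XN]].
  exact: submodule0.
by apply: submoduleDZ => //; [apply: Nx | apply: Ny].
Qed.

Lemma sub_span (X : set M) : X `<=` span X.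
Proof. exact: sub_gen_smallest. Qed.

Lemma span_min (X N : set M) : submodule N -> X `<=` N -> span X `<=` N.
Proof. exact: smallest_sub. Qed.

Lemma spanS (X Y : set M) : X `<=` Y -> span X `<=` span Y.
Proof.
move=> XY; apply: span_min; first exact: span_submodule.
by move=> x /XY /sub_span.
Qed.

Lemma span0 x : span (set0 : set M) x -> x = 0.
Proof.
apply: (@span_min _ [set 0]) => //; apply/submoduleP; split=> // a u v -> ->.
by rewrite /= scaler0 addr0.
Qed.

Lemma smul_mem I N a x : I a -> N x -> smul I N (a *: x).
Proof. by move=> Ia Nx; apply: sub_span; exists a => //; exists x. Qed.

Lemma smul_submodule I N : submodule (smul I N).
Proof. exact: span_submodule. Qed.

Lemma smul_min I N K : submodule K ->
  (forall a x, I a -> N x -> K (a *: x)) -> smul I N `<=` K.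
Proof.
by move=> subK IN_K; apply: span_min => // _ [a Ia [x Nx <-]]; apply: IN_K.
Qed.

Lemma smulS I N K : N `<=` K -> smul I N `<=` smul I K.
Proof.
move=> NK; apply: smul_min => [|a x Ia Nx]; first exact: smul_submodule.
by apply: smul_mem => //; apply: NK.
Qed.

Lemma annihilated_submodule a : submodule [set x : M | a *: x = 0].
Proof.
apply/submoduleP; split=> [|b x y /= x0 y0]; first exact: scaler0.
by rewrite scalerDr y0 addr0 scalerA mulrC -scalerA x0 scaler0.
Qed.

Lemma span_fin_gen N : fin_gen N -> exists s : seq M, N = span [set` s].
Proof. by case=> X /finite_seqP[s ->] ->; exists s. Qed.

End Submodules.

(** * Finite generation of submodules over a Noetherian ring *)

Section Smul.
Context {R : comNzRingType} {M : lmodType R}.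
Implicit Types (N K W : set M) (I J : set R).

(** With [x] fixed, [smul_min] can then reduce a claim about all scalars of a product of ideals to
    products [a * b] of their elements. *)
Lemma transporter_submodule N x :
  submodule N -> submodule ([set a | N (a *: x)] : set R^o).
Proof.
move=> subN; apply/submoduleP; split=> [|a b c /= Nb Nc].
  by rewrite /= scale0r; apply: submodule0.
by rewrite scalerDl -scalerA; apply: submoduleDZ.
Qed.

Lemma coefficient_submodule N K x : submodule N -> submodule K ->
  submodule ([set a | exists2 y, N y & K (y - a *: x)] : set R^o).
Proof.
move=> subN subK; apply/submoduleP; split=> [|a b c [y Ny Ky] [z Nz Kz]].
  by exists 0; rewrite ?scale0r ?subr0; apply: submodule0.
exists (a *: y + z); first exact: submoduleDZ.
by rewrite scalerDl opprD addrACA -scalerA -scalerBr; apply: submoduleDZ.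
Qed.

Lemma smul_ideal_mul I J N : smul (ideal_mul I J) N `<=` smul I (smul J N).
Proof.
apply: smul_min => [|a x IJa Nx]; first exact: smul_submodule.
move: a IJa; apply: (smul_min (transporter_submodule x (smul_submodule _ _))).
by move=> a b Ia Jb /=; rewrite -scalerA; do 2![apply: smul_mem => //].
Qed.

Lemma span_cons x (s : seq M) y :
  span [set` x :: s] y -> exists a, span [set` s] (y - a *: x).
Proof.
have subS := span_submodule [set` s].
apply: (span_min (N := [set y | exists a, span [set` s] (y - a *: x)])).
  apply/submoduleP; split=> [|a u v [b ub] [c vc]].
    by exists 0; rewrite scale0r subr0; apply: (submodule0 subS).
  exists (a * b + c); rewrite scalerDl opprD addrACA -scalerA -scalerBr.
  exact: (submoduleDZ subS).
move=> z; rewrite /= inE => /predU1P[->|sz].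
  by exists 1; rewrite scale1r subrr; apply: (submodule0 subS).
by exists 0; rewrite scale0r subr0; apply: sub_span.
Qed.

(** Induction on the number of generators. The coefficients of [x] in elements of [N], modulo the
    span of [s], form an ideal. Lifts to [N] of its finitely many generators, together with
    generators of [N] ∩ span [s], generate [N]. *)
Lemma fin_gen_submodule N (s : seq M) :
  noetherian R -> submodule N -> N `<=` span [set` s] -> fin_gen N.
Proof.
move=> noethR; elim: s N => [|x s IHs] N subN Ns.
  exists set0 => //; apply/seteqP; split=> [y|].
    move/Ns => /= ys; have -> : y = 0 by apply: span0; apply: spanS ys => z.
    exact: submodule0 (span_submodule _).
  by apply: span_min.
have subS := span_submodule [set` s].
pose I : set R^o := [set a | exists2 y, N y & span [set` s] (y - a *: x)].
have subI : submodule I by apply: coefficient_submodule.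
have [t defI] := span_fin_gen (noethR I subI).
(* [f] lifts a coefficient in [I] to an element of [N]; off [I] its value is the dummy 0. *)
have /choice[f fP] (a : R) : exists y, I a -> N y /\ span [set` s] (y - a *: x).
  have [[y Ny ys]|notI] := pselect (I a); last by exists 0.
  by exists y.
have tI a : a \in t -> I a by move=> ta; rewrite defI; apply: sub_span.
have [|y []//|X finX defX] := IHs (N `&` span [set` s]).
  exact: submoduleI.
pose Y := [set` map f t] `|` X.
exists Y; first by rewrite finite_setU; split=> //; apply/finite_seqP; eexists.
have XY : N `&` span [set` s] `<=` span Y.
  by rewrite defX; apply: spanS => y Xy; right.
have subY := span_submodule Y.
have fY a : a \in t -> span Y (f a).
  by move=> ta; apply: sub_span; left; apply: map_f.
have Y_N : span Y `<=` N.
  apply: span_min => // y [/mapP[a /tI /fP[Ny _] ->]//|Xy].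
  have : span X y by apply: sub_span.
  by rewrite -defX => -[].
apply/seteqP; split=> // y Ny.
have [a ya] := span_cons (Ns y Ny).
have : I a by exists y.
have : I `<=` [set a | exists2 z, span Y z & span [set` s] (z - a *: x)].
  rewrite defI; apply: span_min => [|b tb /=].
    exact: coefficient_submodule.
  by exists (f b); [apply: fY | case: (fP b (tI b tb))].
move/[apply] => -[z Yz zs].
(* [y] and [z] have the same coefficient at [x], so [y - z] falls into [N] ∩ span [s]. *)
rewrite -(subrK z y); apply: (submoduleD subY) => //; apply: XY; split.
  by apply: (submoduleB subN) => //; apply: Y_N.
have -> : y - z = (y - a *: x) - (z - a *: x) by rewrite opprB addrA subrK.
exact: (submoduleB subS).
Qed.

End Smul.

(** For [p] prime and [N] a submodule, this is the preimage of the localization N_p under M ->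
    M_p. *)
Definition saturation (R : comNzRingType) (M : lmodType R) (p : set R)
    (N : set M) : set M :=
  [set x | exists2 s, ~ p s & N (s *: x)].

(** * Saturation at a prime, Nakayama's lemma and supports *)

Section Prime.
Context {R : comNzRingType} {p : set R} (pp : prime_ideal p).

Lemma prime_ideal1 : ~ p 1.
Proof. by case: pp => -[_ /negP + _] _; rewrite inE. Qed.

Lemma prime_ideal_submodule : submodule (p : set R^o).
Proof.
case: pp => -[p0 _ pL] _; apply/submoduleP; split=> [|a b c pb pc].
  by move: p0; rewrite inE.
by have := pL a b c; rewrite !inE; apply.
Qed.

Lemma prime_idealM a b : p (a * b) -> p a \/ p b.
Proof.
case: pp => _ pM pab; have := pM a b; rewrite !inE => /(_ pab).
by case/orP; rewrite inE; [left|right].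
Qed.

Lemma prime_idealMN a b : ~ p a -> ~ p b -> ~ p (a * b).
Proof. by move=> pa pb /prime_idealM[]. Qed.

Context {M : lmodType R}.
Implicit Types N K W : set M.

Lemma sub_saturation N : N `<=` saturation p N.
Proof. by move=> x Nx; exists 1; [apply: prime_ideal1 | rewrite scale1r]. Qed.

Lemma saturationP N s x : ~ p s -> saturation p N (s *: x) -> saturation p N x.
Proof.
move=> ps [t pt]; rewrite scalerA => Nx; exists (t * s) => //.
exact: prime_idealMN.
Qed.

Lemma saturation_submodule N : submodule N -> submodule (saturation p N).
Proof.
move=> subN; apply/submoduleP; split.
  by apply: sub_saturation; apply: submodule0.
move=> a x y [s ps Nx] [t pt Ny]; exists (t * s); first exact: prime_idealMN.
rewrite scalerDr; apply: submoduleD => //.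
  by rewrite scalerA mulrAC -scalerA; apply: submoduleZ.
by rewrite mulrC -scalerA; apply: submoduleZ.
Qed.

Lemma smul_span_cons x (s : seq M) y :
  smul p (span [set` x :: s]) y ->
  exists2 a, p a & smul p (span [set` s]) (y - a *: x).
Proof.
set P := smul p (span [set` s]).
have subP : submodule P := smul_submodule _ _.
have subp := prime_ideal_submodule.
apply: (smul_min (K := [set y | exists2 a, p a & P (y - a *: x)])).
  apply/submoduleP; split=> [|a u v [b pb ub] [c pc vc]].
    exists 0; first exact: submodule0 subp.
    by rewrite scale0r subr0; apply: (submodule0 subP).
  exists (a * b + c); first exact: (submoduleDZ subp).
  rewrite scalerDl opprD addrACA -scalerA -scalerBr.
  exact: (submoduleDZ subP).
move=> c z pc /span_cons[a za]; exists (c * a).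
  by rewrite mulrC; apply: (submoduleZ subp).
by rewrite -scalerA -scalerBr; apply: smul_mem.
Qed.

(* Gaussian elimination in place of the determinant trick: modulo [p] the
   coefficient matrix of the relations is diagonal with nonzero entries. *)
Lemma nakayama_seq (s : seq M) :
  (forall x, x \in s -> saturation p (smul p (span [set` s])) x) ->
  exists2 u, ~ p u & forall x, x \in s -> u *: x = 0.
Proof.
elim: s => [|x s IHs] sat_s; first by exists 1 => //; apply: prime_ideal1.
have subp := prime_ideal_submodule.
set P := smul p (span [set` s]) in IHs.
have subP : submodule P := smul_submodule _ _.
have [t pt /smul_span_cons[a pa]] := sat_s x (mem_head _ _).
(* The pivot: moving the [x]-term of the relation for [x] to the left gives the coefficient [t'],
   still outside [p]. *)
rewrite -scalerBl -/P; set t' := t - a => Px.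
have pt' : ~ p t'.
  by move=> pt'; apply: pt; rewrite -(subrK a t); apply: (submoduleD subp).
have [w sw|u pu us0] := IHs.
  have [|c pc /smul_span_cons[b pb Pw]] := sat_s w.
    by rewrite inE sw orbT.
  (* Multiplying the relation for [w] by the pivot eliminates [x], because [t' *: x] is in [P]. *)
  exists (t' * c); first exact: prime_idealMN.
  rewrite -scalerA -(subrK (b *: x) (c *: w)) scalerDr.
  apply: (submoduleD subP) => //; first exact: (submoduleZ subP).
  by rewrite scalerA mulrC -scalerA; apply: (submoduleZ subP).
have uS y : span [set` s] y -> u *: y = 0.
  exact: (span_min (annihilated_submodule u)).
have uP y : P y -> u *: y = 0.
  apply: (smul_min (annihilated_submodule u)) => b z _ /uS z0 /=.
  by rewrite scalerA mulrC -scalerA z0 scaler0.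
exists (u * t'); first exact: prime_idealMN.
move=> w; rewrite inE => /predU1P[->|sw]; first by rewrite -scalerA uP.
by rewrite mulrC -scalerA us0 // scaler0.
Qed.

Lemma nakayama W : fin_gen W -> W `<=` saturation p (smul p W) ->
  exists2 u, ~ p u & forall x, W x -> u *: x = 0.
Proof.
move=> /span_fin_gen[s ->] sat_s.
have [x sx|u pu us] := nakayama_seq (s := s).
  by apply: sat_s; apply: sub_span.
by exists u => //; apply: (span_min (annihilated_submodule u)).
Qed.

(** If such a [u] killed [K], it would witness the equality of any two fractions, so the
    localization would have a single class. *)
Lemma supp_annihilator K u : submodule K -> supp K p -> ~ p u ->
  ~ forall x, K x -> u *: x = 0.
Proof.
move=> subK [_ nz] pu uK; apply: nz.
have K0 := submodule0 subK.
have fracE x s : K x -> fraction p K x s = K `*` ~` p.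
  move=> Kx; apply/seteqP; split=> -[y t]; first by case.
  case=> Ky pt; split=> //; exists u => //; apply: uK.
  by apply: submoduleB => //; apply: submoduleZ.
apply/seteqP; split=> C.
  by case=> -[x s] [Kx _] <-; rewrite /= !fracE.
by move=> ->; exists (0, 1) => //; split=> //; apply: prime_ideal1.
Qed.

End Prime.

(** * Residuals, regular prime extensions and their chains *)

Section Tower.
Context {R : comNzRingType} {M : lmodType R}.
Implicit Types (N K L : set M) (p : set R).

(** The submodule (N :_M p) of [M], whereas [colon] is an ideal of [R]. *)
Definition residual p N : set M := [set x | forall a, p a -> N (a *: x)].

Lemma residual_submodule p N : submodule N -> submodule (residual p N).
Proof.
move=> subN; apply/submoduleP; split=> [a _|a x y px py b pb].
  by rewrite scaler0; apply: submodule0.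
rewrite scalerDr scalerA mulrC -scalerA.
by apply: submoduleDZ => //; [apply: px | apply: py].
Qed.

Lemma sub_residual p N : submodule N -> N `<=` residual p N.
Proof. by move=> subN x Nx a _; apply: submoduleZ. Qed.

(** By the last hypothesis, scalars outside [p] act injectively on the residual modulo [N]; this
    gives primeness with colon [p]. A [p]-prime extension is carried into [N] by [p], so it lies in
    the residual: maximality. If [q] contains [p] and annihilates a nonzero class of [y], then [y]
    is in the residual, and injectivity forces [q] into [p]: regularity. *)
Lemma residual_regular p N : prime_ideal p -> submodule N ->
    residual p N <> N ->
    (forall s x, ~ p s -> residual p N x -> N (s *: x) -> N x) ->
  regular_prime_extension p N (residual p N).
Proof.
move=> pp subN neqN satN.
have NP := sub_residual (p := p) subN.
have /existsNP[x /not_implyP[Px notNx]] : ~ residual p N `<=` N.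
  by move=> PN; apply: neqN; apply/seteqP.
have colonE : colon N (residual p N) = p.
  apply/seteqP; split=> a; last by move=> pa y; apply.
  move=> Na; apply: contrapT => pa; apply: notNx.
  exact: satN pa Px (Na x Px).
split.
  split=> [|L [[subN' subL NL primeL] colonL] PL].
    split=> //; split=> //; first exact: residual_submodule.
      by split=> // PN; apply: notNx; apply: PN.
    move=> a y Py Nay; rewrite colonE.
    by have [pa|pa] := pselect (p a); [left | right; apply: satN Nay].
  apply/seteqP; split=> // y Ly a; rewrite -colonL; exact.
split.
  split=> //; exists x; apply/seteqP; split=> a.
    by move=> pa _ ->; apply: Px.
  move=> /(_ x erefl) Nax; apply: contrapT => pa; apply: notNx.
  exact: satN pa Px Nax.
move=> q [pq [y qE]] pq_sub; apply/seteqP; split=> // a qa.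
have Py : residual p N y by move=> b /pq_sub; rewrite qE; apply.
have notNy : ~ N y.
  by move=> Ny; apply: (prime_ideal1 pq); rewrite qE => _ ->; rewrite scale1r.
apply: contrapT => pa; apply: notNy; apply: satN pa Py _.
by move: qa; rewrite qE; apply.
Qed.

(** A recursive form of [rpe_filtration], which makes concatenation easy. *)
Fixpoint rpe_chain N (q : seq (set R)) K : Prop :=
  if q is p :: q' then
    exists2 L, regular_prime_extension p N L & rpe_chain L q' K
  else N = K.

Lemma rpe_chain_cat N q L q' K :
  rpe_chain N q L -> rpe_chain L q' K -> rpe_chain N (q ++ q') K.
Proof.
elim: q N => [|p q IHq] N /=; first by move=> ->.
by case=> N' reg chain chain'; exists N' => //; apply: IHq.
Qed.

Lemma rpe_chain_filtration N q : rpe_chain N q setT ->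
  exists F, rpe_filtration N F q.
Proof.
elim: q N => [|p q IHq] N /=; first by move=> ->; exists (fun=> setT).
case=> L reg /IHq[F [F0 FT Freg]].
exists (fun i => if i is j.+1 then F j else N); split=> // -[|i] //=.
  by rewrite F0.
exact: Freg.
Qed.

(** * The tower of residuals for one prime *)

Section Block.
Variables (p : set R) (K : set M) (r : nat).
Hypotheses (pp : prime_ideal p) (subK : submodule K).
Hypothesis resK : residual p K `<=` K.

Let S := saturation p (smul (ideal_exp p r) K).
Definition block k : set M := iter k (residual p) (K `&` S).

Let subS : submodule S.
Proof. exact/saturation_submodule/smul_submodule. Qed.

Lemma block_submodule k : submodule (block k).
Proof.
elim: k => [|k IHk]; first exact: submoduleI.
exact: residual_submodule.
Qed.

Lemma sub_block k : block k `<=` K.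
Proof.
elim: k => [|k IHk] x; first by case.
by move=> kx; apply: resK => a pa; apply/IHk/kx.
Qed.

Lemma block_saturated k s x : ~ p s -> K x -> block k (s *: x) -> block k x.
Proof.
move=> ps; elim: k x => [|k IHk] x Kx.
  by case=> _ Ssx; split=> //; apply: saturationP Ssx.
move=> ksx a pa; apply: IHk; first exact: submoduleZ.
by rewrite scalerA mulrC -scalerA; apply: ksx.
Qed.

(** Iterating the residual by [p] amounts to one residual by the power [p]^k, taken inside [K]. *)
Lemma block_ideal_exp k x :
  block k x <-> K x /\ forall b, ideal_exp p k b -> S (b *: x).
Proof.
split.
  move=> kx; split; first exact: sub_block kx.
  elim: k x kx => [|k IHk] x; first by case=> _ Sx b _; apply: submoduleZ.
  move=> kx; apply: (smul_min (transporter_submodule x subS)) => a b pa kb.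
  by rewrite /= [a *: b]mulrC -scalerA; apply: IHk => //; apply: kx.
elim: k x => [|k IHk] x [Kx Sx].
  by split=> //; rewrite -[x]scale1r; apply: Sx.
move=> a pa; apply: IHk; split=> [|b kb]; first exact: submoduleZ.
by rewrite scalerA mulrC; apply: Sx; apply: (smul_mem (M := R^o)).
Qed.

Lemma block_top : block r = K.
Proof.
apply/seteqP; split=> [|x Kx]; first exact: sub_block.
apply/block_ideal_exp; split=> // b rb.
by apply: (sub_saturation pp); apply: smul_mem.
Qed.

Hypothesis fgM : forall N, submodule N -> fin_gen N.
Hypothesis nz : forall u, ~ p u ->
  ~ forall x, smul (ideal_exp p r.-1) K x -> u *: x = 0.

Lemma block_strict k : (k < r)%N -> block k.+1 <> block k.
Proof.
move=> ltkr eqk.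
have stable j : block (k + j) = block k.
  elim: j => [|j IHj]; first by rewrite addn0.
  by rewrite addnS /block iterS -/(block _) IHj.
(* Both [r.-1] and [r] are at least [k], so the tower has already reached [K] at [r.-1]. *)
have topK : block r.-1 = K.
  have le_kr : (k <= r.-1)%N by rewrite -ltnS (ltn_predK ltkr).
  by rewrite -block_top -(subnKC le_kr) -(subnKC (ltnW ltkr)) !stable.
pose W := smul (ideal_exp p r.-1) K.
have [||u pu uW] := @nakayama _ _ pp _ W; last exact: nz pu uW.
  exact/fgM/smul_submodule.
have SW : S `<=` saturation p (smul p W).
  move=> x [s ps]; rewrite -{1}(ltn_predK ltkr) => sx; exists s => //.
  exact: smul_ideal_mul.
(* By [block_ideal_exp] at [r.-1], [topK] says that [p]^(r-1) carries [K] into [S]. *)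
move=> x Wx; apply: SW; move: x Wx; apply: smul_min => // a x ra Kx.
by move: Kx; rewrite -{1}topK => /block_ideal_exp[_]; apply.
Qed.

Lemma block_chain : rpe_chain (block 0) (nseq r p) K.
Proof.
(* Induct on the number [m] of steps left below the top, for a varying start [k]. *)
suff chain m k : (k + m)%N = r -> rpe_chain (block k) (nseq m p) K.
  exact: chain.
elim: m k => [|m IHm] k /= kmr; first by rewrite -block_top -kmr addn0.
exists (block k.+1); last by apply: IHm; rewrite addSnnS.
apply: residual_regular => //; first exact: block_submodule.
  by apply: block_strict; rewrite -kmr addnS ltnS leq_addr.
by move=> s x ps kx; apply: block_saturated => //; apply: (@sub_block k.+1).
Qed.

End Block.
End Tower.

(** The last two conclusions are invariants of the induction on [s]. The inclusion of the product
    transfers the support hypothesis to the submodule built so far; the clause on [q] keeps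
    residuals by the next prime inside it. *)
Lemma exists_rpe_chain (R : comNzRingType) (M : lmodType R) (n : nat)
    (p : 'I_n -> set R) (r : 'I_n -> nat) (s : seq 'I_n) :
    (forall N : set M, submodule N -> fin_gen N) ->
    (forall i, prime_ideal (p i)) ->
    (forall i j : 'I_n, (i < j)%N -> ~ (p i `<=` p j)) ->
    sorted (fun i j : 'I_n => i < j)%N s ->
    (forall i, i \in s ->
       supp (smul (ideal_mul (ideal_exp (p i) (r i).-1)
                     (\big[@ideal_mul R/setT]_(j <- s | (i < j)%N)
                         ideal_exp (p j) (r j)))
                  [set: M])
            (p i)) ->
  exists N : set M,
    [/\ submodule N,
        rpe_chain N (flatten [seq nseq (r i) (p i) | i <- s]) setT,
        smul (\big[@ideal_mul R/setT]_(j <- s) ideal_exp (p j) (r j)) setT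
          `<=` N
      & forall q, (forall i, i \in s -> ~ (q `<=` p i)) -> residual q N `<=` N].
Proof.
move=> fgM p_prime p_ord; elim: s => [|i s IHs] s_sorted s_supp.
  by exists setT; split=> //; apply: submoduleT.
(* Hence the filter [i < j] keeps all of [s] in the product for [i], and removes [i] from the
   products for later indices. *)
have ltis : all (fun j : 'I_n => (i < j)%N) s.
  by apply: order_path_min s_sorted => a b c; apply: ltn_trans.
have [||K [subK chainK AK resK]] := IHs; first exact: path_sorted s_sorted.
  move=> j sj; have := s_supp j; rewrite inE sj orbT => /(_ isT).
  by rewrite big_cons ltnNge ltnW //; apply: (allP ltis).
have resKi : residual (p i) K `<=` K.
  by apply: resK => j /(allP ltis); apply: p_ord.
have nz u : ~ p i u ->
    ~ forall x, smul (ideal_exp (p i) (r i).-1) K x -> u *: x = 0.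
  move=> pu uK; have := s_supp i (mem_head _ _).
  rewrite big_cons ltnn -big_filter (all_filterP ltis).
  move/(supp_annihilator (p_prime i) (smul_submodule _ _)) => /(_ u pu); apply.
  by move=> x /smul_ideal_mul /(smulS AK); apply: uK.
pose N := block (p i) K (r i) 0.
exists N; split; first exact: block_submodule.
- by apply: rpe_chain_cat chainK; apply: block_chain.
- rewrite big_cons => x /smul_ideal_mul /(smulS AK) ix; split.
    by move: x ix; apply: smul_min => // a y _; apply: submoduleZ.
  exact: sub_saturation.
- move=> q qs x qx.
  have Kx : K x.
    apply: resK => [j sj|a qa]; last by case: (qx a qa).
    by apply: qs; rewrite inE sj orbT.
  (* Some [a] in [q] lies outside [p i]; as [a *: x] is in [N], saturation at [p i] brings [x] into
     [N]. *)
  have /existsNP[a /not_implyP[qa pa]] := qs i (mem_head _ _).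
  exact: (block_saturated (p_prime i) subK pa Kx (qx a qa)).
Qed.

Theorem theorem2p5 (R : comNzRingType) (M : lmodType R) (n : nat)
    (p : 'I_n -> set R) (r : 'I_n -> nat)
    (R_noeth : noetherian R)
    (M_fg : fin_gen [set: M])
    (n_gt0 : (0 < n)%N)
    (p_prime : forall i, prime_ideal (p i))
    (p_inj : injective p)
    (p_ord : forall i j : 'I_n, (i < j)%N -> ~ (p i `<` p j))
    (r_gt0 : forall i, (0 < r i)%N)
    (p_supp : forall i : 'I_n,
       supp (smul (ideal_mul (ideal_exp (p i) (r i).-1)
                     (\big[@ideal_mul R/setT]_(j < n | (i < j)%N)
                         ideal_exp (p j) (r j)))
                  [set: M])
            (p i)) :
  exists N : set M, gen_prime_factorization N (formal_prod p r).
Proof.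
have [t defM] := span_fin_gen M_fg.
have fgM (N : set M) : submodule N -> fin_gen N.
  by move=> subN; apply: (fin_gen_submodule (s := t)) => //; rewrite -defM.
(* Distinctness of the primes upgrades the failure of strict inclusion to the failure of
   inclusion. *)
have p_nsub (i j : 'I_n) : (i < j)%N -> ~ (p i `<=` p j).
  move=> ltij pij; apply: (p_ord _ _ ltij); split=> // pji.
  by move: ltij; rewrite (p_inj i j) ?ltnn //; apply/seteqP.
have [||N [subN chainN _ _]] :=
  @exists_rpe_chain R M n p r (enum 'I_n) fgM p_prime p_nsub.
- by rewrite -(sorted_map (f := val) (e' := ltn)) val_enum_ord iota_ltn_sorted.
- by move=> i _; have := p_supp i; rewrite [index_enum _]unlock -enumT.
exists N; split=> //.
  (* Properness: since [n] and [r ord0] are positive, the chain has a first step, and it is a strict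
     inclusion. *)
  move: chainN.
  case: n n_gt0 p r r_gt0 {p_prime p_inj p_ord p_supp p_nsub} => // n _ p r.
  rewrite enum_ordSl /= => /(_ ord0); case: (r ord0) => // m _ /=.
  case=> L [[[[_ _ [NL LN] _] _] _] _] _; split=> // TN.
  by apply: LN => x _; apply: TN.
have [F FN] := rpe_chain_filtration chainN.
by exists F, (formal_prod p r).
Qed.
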